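(* Let $P\subset\mathbb{R}^m$ be an integral polytope with non-empty interior and $d_N=\#(NP\cap\mathbb{Z}^m)$. Assume that $a_j$ are i.i.d. complex (or real) valued random variables whose distribution law $\mathbf{P}$ is of the form $\mathbf{P}=\phi(z)\,dz$ (or $\mathbf{P}=\phi(x)\,dx$), where $\phi$ is a real valued bounded function, and that for some constants $C>0$ and $\rho>m+1$ $$\mathbf{P}\{z\in\mathbb{C}:\log|z|>R\}\le\frac{C}{R^\rho}\quad\text{for }R\ge1 .$$ Then the $d_N$-fold product measures $\sigma_N$ on $\mathbb{C}^{d_N}$ induced by $\mathbf{P}$ satisfy the following three conditions: (1) $\displaystyle\sup_{u\in S^{2d_N-1}}\Big|\int_{\mathbb{C}^{d_N}}\log|\langle a,u\rangle|\,d\sigma_N(a)\Big|=o(N)$ as $N\to\infty$; (2) $\displaystyle\sum_{N=1}^\infty\sigma_N\big(a\in\mathbb{C}^{d_N}:\log\|a\|>N\epsilon\big)<\infty$ for every $\epsilon>0$; (3) for every choice of unit vectors $u=u_N\in S^{2d_N-1}$ $(N\ge1)$, $\displaystyle\sum_{N=1}^\infty\sigma_N\big(a\in\mathbb{C}^{d_N}:\log|\langle a,u\rangle|<-Nt\big)<\infty$ for every $t>0$.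
   Context: An integral polytope is the convex hull of a non-empty finite subset of $\mathbb{Z}^m$; $NP$ is the $N$-th dilate of $P$. $\langle a,u\rangle=\sum_ja_ju_j$, $\|a\|$ is the Euclidean norm, and $S^{2d_N-1}$ is the unit sphere in $\mathbb{C}^{d_N}$. $dz$ (resp. $dx$) is Lebesgue measure on $\mathbb{C}$ (resp. $\mathbb{R}$). In the real case $\mathbf{P}$ is regarded as a measure on $\mathbb{C}$ supported on $\mathbb{R}$. *)

(* Defs.v *)
From HB Require Import structures.
From mathcomp Require Import all_boot all_order all_algebra.
From mathcomp Require Import finmap.
From mathcomp Require Import all_classical all_reals all_analysis.
From mathcomp Require Import complex.

Set Implicit Arguments.
Unset Strict Implicit.
Unset Printing Implicit Defensive.

Import Order.TTheory GRing.Theory Num.Theory.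
Import numFieldNormedType.Exports.
Import Normc.

Local Open Scope classical_set_scope.
Local Open Scope ring_scope.
Local Open Scope complex_scope.

Section complex_measurable.
Variable R : realType.

HB.instance Definition _ := isPointed.Build R[i] 0.

Definition complex_of_pair (p : measurableTypeR R * measurableTypeR R) : R[i] := p.1 +i* p.2.

(* The Borel sigma-algebra of C, transported from the product sigma-algebra of
   R x R along the bijection (x, y) |-> x + iy. *)
Definition measurable_complex : set (set R[i]) :=
  [set A | measurable (complex_of_pair @^-1` A)].

Let measurable_complex0 : measurable_complex set0.
Proof. by rewrite /measurable_complex /= preimage_set0. Qed.

Let measurable_complexC A : measurable_complex A -> measurable_complex (~` A).
Proof.
by move=> mA; rewrite /measurable_complex /= preimage_setC; exact: measurableC.
Qed.

Let measurable_complex_bigcup (F : (set R[i])^nat) :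
  (forall k, measurable_complex (F k)) -> measurable_complex (\bigcup_k F k).
Proof.
move=> mF; rewrite /measurable_complex /= preimage_bigcup.
exact: bigcupT_measurable.
Qed.

HB.instance Definition _ := @isMeasurable.Build default_measure_display R[i]
  measurable_complex measurable_complex0 measurable_complexC
  measurable_complex_bigcup.

Lemma measurable_complex_of_pair : measurable_fun setT complex_of_pair.
Proof. by move=> _ A mA; rewrite setTI. Qed.

Definition lebesgue_measureC : set R[i] -> \bar R :=
  pushforward (lebesgue_measure \x lebesgue_measure)%E complex_of_pair.

Let lebesgue_measureC0 : lebesgue_measureC set0 = 0%E.
Proof. by rewrite /lebesgue_measureC /pushforward preimage_set0 measure0. Qed.

Let lebesgue_measureC_ge0 A : (0 <= lebesgue_measureC A)%E.
Proof. by rewrite /lebesgue_measureC /pushforward measure_ge0. Qed.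

Let lebesgue_measureC_sigma_additive : semi_sigma_additive lebesgue_measureC.
Proof.
move=> F mF tF mUF; rewrite /lebesgue_measureC /pushforward preimage_bigcup.
apply: measure_semi_sigma_additive => //.
apply/trivIsetP => i j _ _ ij; rewrite -preimage_setI.
by move/trivIsetP : tF => ->//; rewrite preimage_set0.
Qed.

HB.instance Definition _ := isMeasure.Build _ _ _ lebesgue_measureC
  lebesgue_measureC0 lebesgue_measureC_ge0 lebesgue_measureC_sigma_additive.

(* [P = phi(z) dz]. *)
Definition complex_density (P : set R[i] -> \bar R) (phi : R[i] -> R) :=
  measurable_fun setT phi /\
  forall A, measurable A ->
    P A = (\int[lebesgue_measureC]_(z in A) (phi z)%:E)%E.

(* [P = phi(x) dx], regarded as a measure on C supported on R. *)
Definition real_density (P : set R[i] -> \bar R) (phi : R -> R) :=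
  measurable_fun setT phi /\
  forall A, measurable A ->
    P A = (\int[lebesgue_measure]_(x in [set x | A x%:C]) (phi x)%:E)%E.

End complex_measurable.

Section product_probability.
Context {d} {T : measurableType d} {R : realType}.

Definition tuple_cons n (p : T * n.-tuple T) : n.+1.-tuple T :=
  [tuple of p.1 :: p.2].

Lemma measurable_tuple_cons n : measurable_fun setT (@tuple_cons n).
Proof. exact: measurable_cons measurable_fst measurable_snd. Qed.

HB.instance Definition _ n :=
  isMeasurableFun.Build _ _ _ _ (@tuple_cons n) (@measurable_tuple_cons n).

(* The n-fold product P x ... x P on T^n, see [power_probabilityE]. *)
Fixpoint power_probability (P : probability T R) n :
    probability (n.-tuple T) R :=
  if n is n'.+1 then
    distribution (P \x power_probability P n')%E (@tuple_cons n')
  else dirac [tuple].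

End product_probability.

Section power_probabilityE.
Context {d} {T : measurableType d} {R : realType} (P : probability T R).

Lemma power_probabilityE n (A : 'I_n -> set T) :
  (forall i, measurable (A i)) ->
  power_probability P n [set x | forall i, A i (tnth x i)] =
  (\prod_(i < n) P (A i))%E.
Proof.
elim: n A => [|n IHn] A mA /=.
  rewrite big_ord0 diracE mem_set//; by case.
rewrite big_ord_recl -IHn; last by move=> i; exact: mA.
rewrite -product_measure1E//; last first.
  rewrite [X in measurable X](_ : _ =
      \bigcap_(i in [set: 'I_n]) ((@tnth n T ^~ i) @^-1` A (lift ord0 i))).
    apply: fin_bigcap_measurable => // i _.
    by rewrite -[X in measurable X]setTI; exact: measurable_tnth.
  by apply/seteqP; split=> [x xA i _|x xA i]; [exact: xA|exact: (xA i I)].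
rewrite /distribution /pushforward; congr (_ _).
apply/seteqP; split => [[x t]/= xA|[x t]/= [xA tA] i].
  split; first exact: (xA ord0).
  by move=> i; have := xA (lift ord0 i); rewrite tnthS.
by case: (unliftP ord0 i) => [j ->|->]; rewrite ?tnthS.
Qed.
End power_probabilityE.

Section lattice_polytope.
Variables (R : realType) (m : nat).
Implicit Types P A : set 'rV[R]_m.

Definition lattice_point (v : 'rV[int]_m) : 'rV[R]_m := map_mx intr v.

Definition convex_hull A : set 'rV[R]_m := smallest (@convex_set R 'rV[R]_m) A.

Definition integral_polytope P := exists S : set 'rV[int]_m,
  [/\ finite_set S, S !=set0 & P = convex_hull (lattice_point @` S)].

Definition dilate (N : nat) P : set 'rV[R]_m := [set N%:R *: x | x in P].

(* [lattice_count P] = #(P \cap Z^m); [fset_set] is only meaningful on finite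
   sets, which holds for every bounded P. *)
Definition lattice_count P : nat :=
  #|` fset_set [set v : 'rV[int]_m | P (lattice_point v)]|.

End lattice_polytope.

Section complex_vectors.
Variables (R : realType) (n : nat).
Implicit Types a u : n.-tuple R[i].

(* <a, u> is bilinear: no complex conjugation. *)
Definition bilin a u : R[i] := \sum_(j < n) tnth a j * tnth u j.

Definition enorm a : R := Num.sqrt (\sum_(j < n) normc (tnth a j) ^+ 2).

Definition unit_sphere : set (n.-tuple R[i]) := [set u | enorm u = 1].

End complex_vectors.

(* Logarithm of a nonnegative real with values in [-oo, +oo[, so that
   elog 0 = -oo; the library's real-valued [ln] has ln 0 = 0. *)
Definition elog (R : realType) (x : R) : \bar R := lne x%:E.

(* Main.v *)
Require Import Defs.
From mathcomp Require Import all_boot all_order all_algebra finmap.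
From mathcomp Require Import all_classical all_reals all_analysis.
From mathcomp Require Import measurable_realfun complex.
From mathcomp Require Import zify ring lra.
Set Implicit Arguments.
Unset Strict Implicit.
Unset Printing Implicit Defensive.
Import Order.TTheory GRing.Theory Num.Theory.
Import numFieldNormedType.Exports.
Import Normc.
Local Open Scope classical_set_scope.
Local Open Scope ring_scope.

(* Everything follows from two tail bounds, uniform in [n >= 1], in the unit
   vector [u] and in [r > 0]: both [log ||a|| > r] and [|log |<a, u>|| > r] have
   probability at most [K n r^-rho].  Large values: [||a||] and [|<a, u>|] are at
   most [n max_j |a_j|], so if [n <= e^(r/2)] the hypothesis on [P] at level
   [r/2] and a union bound apply, while otherwise [1 <= n e^(-r/2)] makes the
   claim trivial.  Small values: a bounded density charges a ball of radius [q]
   at most [O(q)]; conditioning on all coordinates but one with [|u_j| >= 1/n]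
   gives [P(|<a, u>| < e^-r) = O(n e^-r)].  Since [d_N = O(N^m)] and
   [rho > m + 1], the bounds at [r = N eps] are summable in [N], and integrating
   them above the level [N eps] gives [E |log |<a, u>|| <= N eps + O(1)]. *)

(** * Exponentials against powers, and the series of [N^-s] *)

Section real_estimates.
Variable R : realType.
Implicit Types (r s x lam : R).

Lemma elog_gtE r x : (r%:E < elog x)%E = (expR r < x).
Proof.
rewrite /elog /=; case: (lerP x 0) => x0.
  by rewrite ltNge leNye/= ltNge (le_trans x0) ?expR_ge0.
by rewrite lte_fin -{2}(lnK x0) ltr_expR.
Qed.

Lemma elog_ltE r x : (elog x < r%:E)%E = (x < expR r).
Proof.
rewrite /elog /=; case: (lerP x 0) => x0.
  by rewrite ltNyr (le_lt_trans x0) ?expR_gt0.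
by rewrite lte_fin -{2}(lnK x0) ltr_expR.
Qed.

(** Take [ln y <= y - 1] at [y = x / (2 s)], multiply by [s] and drop the resulting [- s]. *)
Lemma powR_le_expR_half s x : 0 < s -> 0 < x ->
  x `^ s <= expR (s * ln (2 * s)) * expR (x / 2).
Proof.
move=> s0 x0; rewrite /powR gt_eqF// -expRD ler_expR.
have q0 : 0 < x / (2 * s) by rewrite divr_gt0 ?mulr_gt0.
have := le_ln1Dx (x := x / (2 * s) - 1).
rewrite addrCA subrr addr0 => /(_ ltac:(lra)).
rewrite lnM ?posrE ?invr_gt0 ?mulr_gt0// lnV ?posrE ?mulr_gt0// => h.
have {h} := ler_wpM2l (ltW s0) h.
rewrite (_ : s * (x / (2 * s) - 1) = x / 2 - s); last by field; lra.
rewrite mulrBr; lra.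
Qed.

(** A discrete substitute for comparison with the integral of [x^-s]. Factoring [(n+2)^(1-s)] out of
    the right side leaves [e^((s-1)(b-a)) - 1 >= (s-1)(b-a)], and [b - a >= 1/(n+2)]. *)
Lemma powRN_telescope s (n : nat) : 1 < s ->
  (s - 1) * n.+2%:R `^ (- s) <= n.+1%:R `^ (1 - s) - n.+2%:R `^ (1 - s).
Proof.
move=> s1.
have a0 : (0 : R) < n.+1%:R by [].
have b0 : (0 : R) < n.+2%:R by [].
rewrite /powR !gt_eqF//.
set a := ln n.+1%:R; set b := ln n.+2%:R.
have ab : n.+2%:R^-1 <= b - a.
  have q1 : n.+2%:R^-1 < 1 :> R by rewrite invf_lt1// ltr1n.
  have := @le_ln1Dx R (- n.+2%:R^-1).
  rewrite ltrN2 => /(_ q1).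
  have -> : 1 + - n.+2%:R^-1 = n.+1%:R / n.+2%:R :> R.
    by rewrite -[n.+2%:R]natr1; field; lra.
  rewrite lnM ?posrE ?invr_gt0// lnV ?posrE// -/a -/b.
  by rewrite lerNr opprB.
have -> : (1 - s) * a = (1 - s) * b + (s - 1) * (b - a) by lra.
rewrite expRD -{2}[expR ((1 - s) * b)]mulr1 -mulrBr.
have -> : - s * b = (1 - s) * b - b by lra.
rewrite expRD expRN lnK ?posrE// mulrCA ler_pM2l ?expR_gt0//.
rewrite lerBrDl (le_trans _ (expR_ge1Dx _))// lerD2l ler_wpM2l//.
by rewrite subr_ge0 ltW.
Qed.

Lemma nneseries_powRN_lty s : 1 < s ->
  (\sum_(1 <= N <oo) ((N%:R : R) `^ (- s))%:E < +oo)%E.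
Proof.
move=> s1.
suff : (\sum_(1 <= N <oo) ((N%:R : R) `^ (- s))%:E <= (1 + (s - 1)^-1)%:E)%E.
  by move=> /le_lt_trans; apply; rewrite ltry.
apply: lime_le.
  by apply: is_cvg_nneseries => n _ _; rewrite lee_fin powR_ge0.
near=> n.
(* The telescoped remainder [(k+1)^(1-s)] is kept so that the induction closes; it is dropped only
   at the end. *)
have key k : \sum_(1 <= N < k.+2) N%:R `^ (- s) <=
    1 + (s - 1)^-1 * (1 - k.+1%:R `^ (1 - s)) :> R.
  elim: k => [|k ih].
    by rewrite big_nat1 !powR1 subrr mulr0 addr0.
  rewrite big_nat_recr//=; apply: (le_trans (lerD ih (lexx _))).
  have := powRN_telescope k s1.
  rewrite -ler_pdivlMl ?subr_gt0//.
  set u := k.+2%:R `^ (- s); set v := k.+1%:R `^ _; set w := k.+2%:R `^ _.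
  set c := (s - 1)^-1.
  rewrite mulrBr !mulrBr; lra.
have n2 : (2 <= n)%N by near: n; exact: nbhs_infty_ge.
have <- : n.-2.+2 = n by case: (n) n2 => [|[]].
rewrite sumEFin lee_fin (le_trans (key _))// lerD2l.
by rewrite ler_piMr ?invr_ge0 ?subr_ge0 ?(ltW s1)// lerBlDr lerDl powR_ge0.
Unshelve. all: by end_near. Qed.

End real_estimates.

(** * Measurability of complex-valued maps, of [elog], [bilin] and [enorm] *)

Section complex_measurability.
Context {d} {T : measurableType d} {R : realType}.
Implicit Types f g : T -> R[i].

Lemma measurable_fun_complexP f : measurable_fun setT f <->
  measurable_fun setT (fun x => complex.Re (f x)) /\
  measurable_fun setT (fun x => complex.Im (f x)).
Proof.
split=> [mf|[mr mi]].
  suff h (p : R[i] -> R) : measurable_fun setT (p \o @complex_of_pair R) ->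
      measurable_fun setT (p \o f).
    by split; apply: h; [exact: measurable_fst|exact: measurable_snd].
  move=> mp; apply: measurableT_comp mf => _ A mA.
  rewrite setTI; have := mp measurableT A mA.
  by rewrite setTI.
have -> : f = @complex_of_pair R \o
    (fun x => (complex.Re (f x), complex.Im (f x))).
  by apply/funext => x /=; rewrite /complex_of_pair/=; case: (f x).
apply: measurableT_comp; first exact: measurable_complex_of_pair.
exact: measurable_fun_pair.
Qed.

Lemma measurable_funDC f g : measurable_fun setT f -> measurable_fun setT g ->
  measurable_fun setT (fun x => f x + g x).
Proof.
move=> /measurable_fun_complexP[fr fi] /measurable_fun_complexP[gr gi].
apply/measurable_fun_complexP; split.
  by under eq_fun do rewrite raddfD/=; exact: measurable_funD.
by under eq_fun do rewrite raddfD/=; exact: measurable_funD.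
Qed.

Lemma measurable_funMC f (c : R[i]) : measurable_fun setT f ->
  measurable_fun setT (fun x => f x * c).
Proof.
move=> /measurable_fun_complexP[fr fi]; apply/measurable_fun_complexP; split.
  rewrite (_ : (fun=> _) = (fun x => complex.Re (f x) * complex.Re c -
                                     complex.Im (f x) * complex.Im c)).
    by apply: measurable_funB; exact: measurable_funM.
  by apply/funext => x; case: (f x) c => [? ?] [? ?].
rewrite (_ : (fun=> _) = (fun x => complex.Re (f x) * complex.Im c +
                                   complex.Im (f x) * complex.Re c)).
  by apply: measurable_funD; exact: measurable_funM.
by apply/funext => x; case: (f x) c => [? ?] [? ?].
Qed.

Lemma measurable_superlevel (h : T -> R) (s : R) : measurable_fun setT h ->
  measurable [set x | s < h x].
Proof.
move=> mh; rewrite -[X in measurable X]setTI.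
have -> : [set x | s < h x] = h @^-1` `]s, +oo[.
  by apply/seteqP; split=> x /=; rewrite in_itv/= andbT.
exact: mh.
Qed.

Lemma measurable_sublevel (h : T -> R) (s : R) : measurable_fun setT h ->
  measurable [set x | h x < s].
Proof.
move=> mh; rewrite -[X in measurable X]setTI.
have -> : [set x | h x < s] = h @^-1` `]-oo, s[.
  by apply/seteqP; split=> x /=; rewrite in_itv/=.
exact: mh.
Qed.

Lemma measurable_sqrt : measurable_fun setT (@Num.sqrt R).
Proof. by apply: continuous_measurable_fun; exact: sqrt_continuous. Qed.

Lemma measurable_fun_normc f : measurable_fun setT f ->
  measurable_fun setT (fun x => normc (f x)).
Proof.
move=> /measurable_fun_complexP[fr fi].
rewrite (_ : (fun=> _) = (fun x => Num.sqrt (complex.Re (f x) ^+ 2 +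
                                     complex.Im (f x) ^+ 2))).
  apply: measurableT_comp; first exact: measurable_sqrt.
  by apply: measurable_funD; exact: measurable_funX.
by apply/funext => x; case: (f x).
Qed.

(** The upper rays generate the Borel sets of the extended reals, and the ray above [r] pulls back
    to [f > e^r], which also accounts for the value [-oo]. *)
Lemma measurable_fun_elog (f : T -> R) : measurable_fun setT f ->
  measurable_fun setT (fun x => elog (f x)).
Proof.
move=> mf.
apply: (measurability _ (ErealGenOInfty.measurableE R)) => //.
move=> _ [_ [r ->] <-].
rewrite [X in measurable X](_ : _ = setT `&` f @^-1` `]expR r, +oo[).
  by apply: mf => //; exact: measurable_itv.
by apply/seteqP; split=> x [_] /=; rewrite !in_itv/= ?andbT elog_gtE.
Qed.

End complex_measurability.

Section complex_vector_measurability.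
Variables (R : realType) (n : nat).
Implicit Types u : n.-tuple R[i].

Lemma measurable_bilin u : measurable_fun setT (fun a => bilin a u).
Proof.
rewrite /bilin; elim: (index_enum _) => [|j s ih].
  by under eq_fun do rewrite big_nil; exact: measurable_cst.
under eq_fun do rewrite big_cons.
apply: measurable_funDC => //; apply: measurable_funMC.
exact: measurable_tnth.
Qed.

Lemma measurable_enorm : measurable_fun setT (@enorm R n).
Proof.
apply: measurableT_comp; first exact: measurable_sqrt.
apply: measurable_sum => j; apply: measurable_funX.
by apply: measurable_fun_normc; exact: measurable_tnth.
Qed.

End complex_vector_measurability.

(** * Small balls under a bounded density *)

Section small_ball.
Variable R : realType.
Implicit Types (P : probability R[i] R) (w : R[i]).

Lemma measurable_normc_ball w (q : R) :
  measurable [set z : R[i] | normc (z + w) < q].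
Proof.
apply: measurable_sublevel; apply: measurable_fun_normc.
exact: measurable_funDC.
Qed.

Lemma Re_le_normc (z : R[i]) : `|complex.Re z| <= normc z.
Proof.
by case: z => x y /=; rewrite -sqrtr_sqr ler_sqrt ?lerDl ?addr_ge0 ?sqr_ge0.
Qed.

Lemma Im_le_normc (z : R[i]) : `|complex.Im z| <= normc z.
Proof.
by case: z => x y /=; rewrite -sqrtr_sqr ler_sqrt ?lerDr ?addr_ge0 ?sqr_ge0.
Qed.

(** The sign of [phi] is unrestricted, so the estimate passes through [|phi|]. *)
Lemma integral_density_le d (T : measurableType d)
    (mu : {measure set T -> \bar R}) (phi : T -> R) (M : R) (A : set T) :
  0 <= M -> measurable_fun setT phi -> (forall x, `|phi x| <= M) -> measurable A ->
  (\int[mu]_(x in A) (phi x)%:E <= M%:E * mu A)%E.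
Proof.
move=> M0 mphi phiM mA; have mphi' : measurable_fun A (EFin \o phi).
  by apply/measurable_EFinP; exact: measurable_funS mphi.
apply: (le_trans (lee_abs _)).
apply: (le_trans (le_abse_integral _ mA mphi')).
apply: integral_le_bound; rewrite ?lee_fin//.
by apply: aeW => x _ /=; rewrite lee_fin.
Qed.

Lemma complex_density_small_ball P (phi : R[i] -> R) (M : R) :
  (forall z, `|phi z| <= M) -> complex_density P phi ->
  forall w (q : R), 0 < q ->
    (P [set z | normc (z + w) < q]%R <= (M * ((q *+ 2) ^+ 2))%:E)%E.
Proof.
move=> phiM [mphi PE] w q q0.
have M0 : 0 <= M by apply: le_trans (phiM 0).
have mB := measurable_normc_ball w q.
rewrite PE//; apply: (le_trans (integral_density_le _ M0 mphi phiM mB)).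
rewrite EFinM lee_wpmul2l ?lee_fin// /lebesgue_measureC /pushforward.
(* The disc lies in the square of side [2 q] with the same centre, whose area is a product of
   lengths. *)
pose Q := ball (- complex.Re w) q `*` ball (- complex.Im w) q : set (R * R).
have mQ : measurable Q by apply: measurableX; exact: measurable_ball.
rewrite -[leLHS]/((lebesgue_measure \x lebesgue_measure)%E _).
apply: (@le_trans _ _ ((lebesgue_measure \x lebesgue_measure)%E Q)); last first.
  rewrite product_measure1E; [|exact: measurable_ball..].
  rewrite expr2 EFinM; apply: lee_pmul => //.
    by rewrite -(lebesgue_measure_ball (- complex.Re w)) ?(ltW q0).
  by rewrite -(lebesgue_measure_ball (- complex.Im w)) ?(ltW q0).
apply: le_measure; rewrite ?inE//.
move=> [x y]/= xyw; split; rewrite /= /ball /=.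
  rewrite -normrN opprB opprK; apply: le_lt_trans xyw.
  by apply: le_trans (Re_le_normc _); rewrite raddfD.
rewrite -normrN opprB opprK; apply: le_lt_trans xyw.
by apply: le_trans (Im_le_normc _); rewrite raddfD.
Qed.

Lemma real_density_small_ball P (phi : R -> R) (M : R) :
  (forall x, `|phi x| <= M) -> real_density P phi ->
  forall w (q : R), 0 < q ->
    (P [set z | normc (z + w) < q]%R <= (M * (q *+ 2))%:E)%E.
Proof.
move=> phiM [mphi PE] w q q0.
have M0 : 0 <= M by apply: le_trans (phiM 0).
have mB := measurable_normc_ball w q.
have mcast : measurable_fun setT (fun x : R => (x%:C)%C).
  apply/measurable_fun_complexP; split => /=; first exact: measurable_id.
  exact: measurable_cst.
have mB' : measurable [set x : R | [set z | normc (z + w) < q] (x%:C)%C].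
  by rewrite -[X in measurable X]setTI; exact: mcast.
rewrite PE//.
apply: (le_trans (integral_density_le lebesgue_measure M0 mphi phiM mB')).
rewrite EFinM lee_wpmul2l ?lee_fin//.
(* The disc meets the real line inside an interval of length [2 q]. *)
rewrite -(lebesgue_measure_ball (- complex.Re w)) ?(ltW q0)//.
apply: le_measure; rewrite ?inE//; first exact: measurable_ball.
move=> x /= xw; rewrite /ball /=.
rewrite -normrN opprB opprK; apply: le_lt_trans xw.
by apply: le_trans (Re_le_normc _); rewrite raddfD.
Qed.

Lemma bounded_density_small_ball P :
  (exists phi : R[i] -> R,
    (exists M : R, forall z, `|phi z| <= M) /\ complex_density P phi) \/
  (exists phi : R -> R,
    (exists M : R, forall x, `|phi x| <= M) /\ real_density P phi) ->
  exists2 K : R, 0 <= K & forall w (q : R), 0 < q ->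
    (P [set z | normc (z + w) < q]%R <= (K * q)%:E)%E.
Proof.
case=> [[phi [[M phiM] dP]]|[phi [[M phiM] dP]]].
  have M0 : 0 <= M by apply: le_trans (phiM 0).
  (* The planar bound [4 M q^2] is at most [4 M q] when [q <= 1]; beyond that the trivial bound 1 is
     below [q]. Both kinds of density thus give a linear bound. *)
  exists (1 + M * 4) => [|w q q0]; first lra.
  have [q1|q1] := leP q 1.
    apply: (le_trans (complex_density_small_ball phiM dP w q0)).
    rewrite lee_fin (_ : (q *+ 2) ^+ 2 = 4 * q ^+ 2); last by ring.
    have : q ^+ 2 <= q by rewrite expr2 ler_piMl// ltW.
    move=> /(ler_wpM2l M0); nra.
  apply: (le_trans (probability_le1 _ (measurable_normc_ball _ _))).
  rewrite lee_fin; nra.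
have M0 : 0 <= M by apply: le_trans (phiM 0).
exists (M * 2) => [|w q q0]; first lra.
apply: (le_trans (real_density_small_ball phiM dP w q0)).
by rewrite lee_fin -mulrA mulr_natl.
Qed.

End small_ball.

(** * Conditioning and union bounds for the product measure *)

Section power_probability_theory.
Context {d} {T : measurableType d} {R : realType} (P : probability T R).

(** Fubini with the first coordinate frozen: a bound on all sections survives integration against a
    measure of mass 1. *)
Lemma power_probabilityS_le_r n (A : set (n.+1.-tuple T)) (c : \bar R) :
  (0 <= c)%E -> measurable A ->
  (forall z, power_probability P n [set t | A (tuple_cons (z, t))] <= c)%E ->
  (power_probability P n.+1 A <= c)%E.
Proof.
move=> c0 mA Ac; pose B := @tuple_cons _ T n @^-1` A.
have mB : measurable B.
  by rewrite -[B]setTI; exact: measurable_tuple_cons.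
rewrite -[leLHS]/((P \x power_probability P n)%E B) /product_measure1.
rewrite -[leRHS]mule1 -(probability_setT P) -integral_cst//.
apply: ge0_le_integral => //.
  exact: measurable_fun_xsection.
move=> z _; rewrite /= (_ : xsection _ _ = [set t | A (tuple_cons (z, t))])//.
by apply/seteqP; split=> t; rewrite /xsection /= inE.
Qed.

Lemma power_probabilityS_le_l n (A : set (n.+1.-tuple T)) (c : \bar R) :
  (0 <= c)%E -> measurable A ->
  (forall t, P [set z | A (tuple_cons (z, t))] <= c)%E ->
  (power_probability P n.+1 A <= c)%E.
Proof.
move=> c0 mA Ac; pose B := @tuple_cons _ T n @^-1` A.
have mB : measurable B.
  by rewrite -[B]setTI; exact: measurable_tuple_cons.
rewrite -[leLHS]/((P \x power_probability P n)%E B).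
(* [\x] measures sections over the first factor; uniqueness of the product measure permits the
   opposite order of integration. *)
have -> : (P \x power_probability P n)%E B = (P \x^ power_probability P n)%E B.
  by apply: product_measure_unique => // X Y mX mY /=; rewrite product_measure2E.
rewrite /product_measure2.
rewrite -[leRHS]mule1 -(probability_setT (power_probability P n)) -integral_cst//.
apply: ge0_le_integral => //.
  exact: measurable_fun_ysection.
move=> t _; rewrite /= (_ : ysection _ _ = [set z | A (tuple_cons (z, t))])//.
by apply/seteqP; split=> z; rewrite /ysection /= inE.
Qed.

Lemma exists_tnthE n (A : set T) :
  [set a : n.-tuple T | exists j, A (tnth a j)] =
  \big[setU/set0]_(j < n) [set a : n.-tuple T | A (tnth a j)].
Proof.
rewrite -bigcup_seq; apply/seteqP; split=> [a [j Aa]|a [j _ Aa]]; exists j => //=.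
by rewrite mem_index_enum.
Qed.

Lemma measurable_tnth_set n (A : set T) (j : 'I_n) : measurable A ->
  measurable [set a : n.-tuple T | A (tnth a j)].
Proof.
by move=> mA; rewrite -[X in measurable X]setTI; exact: measurable_tnth.
Qed.

Lemma measurable_exists_tnth n (A : set T) : measurable A ->
  measurable [set a : n.-tuple T | exists j, A (tnth a j)].
Proof.
move=> mA; rewrite exists_tnthE; apply: bigsetU_measurable => j _.
exact: measurable_tnth_set.
Qed.

Lemma power_probability_tnth n (A : set T) (j : 'I_n) : measurable A ->
  power_probability P n [set a | A (tnth a j)] = P A.
Proof.
move=> mA; pose G i := if i == j then A else setT.
rewrite (_ : [set a | _] = [set a | forall i, G i (tnth a i)]); last first.
  apply/seteqP; split=> a /= => [Aa i|/(_ j)].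
    by rewrite /G; case: eqP => // ->.
  by rewrite /G eqxx.
rewrite power_probabilityE; last by move=> i; rewrite /G; case: ifP.
rewrite (bigD1 j)//= {1}/G eqxx big1 ?mule1// => i /negbTE ij.
by rewrite /G ij probability_setT.
Qed.

Lemma power_probability_exists_le n (A : set T) : measurable A ->
  (power_probability P n [set a | exists j, A (tnth a j)] <= n%:R%:E * P A)%E.
Proof.
move=> mA; rewrite exists_tnthE.
have -> : (n%:R%:E * P A = \sum_(j < n) P A)%E.
  by rewrite sumr_const card_ord mule_natl.
(* Subadditivity asks for measurable sets, so measurability is carried along the induction. *)
suff [] : measurable (\big[setU/set0]_(j < n) [set a | A (tnth a j)]) /\
    (power_probability P n (\big[setU/set0]_(j < n) [set a | A (tnth a j)]) <=
      \sum_(j < n) P A)%E by [].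
apply: (big_ind2 (fun X y => measurable X /\ (power_probability P n X <= y)%E)).
- by rewrite measure0.
- move=> X x Y y [mX Xx] [mY Yy]; split; first exact: measurableU.
  by apply: (le_trans (measureU2 _ _ _)) => //; exact: leeD.
- move=> j _; rewrite power_probability_tnth//.
  by split=> //; exact: measurable_tnth_set.
Qed.

End power_probability_theory.

(** * Anticoncentration of [<a, u>] *)

Section bilinear_form_anticoncentration.
Variable R : realType.

Lemma normc_ge0 (z : R[i]) : 0 <= normc z.
Proof. by case: z => x y; exact: sqrtr_ge0. Qed.

Lemma bilin_cons n z (t : n.-tuple R[i]) (u : n.+1.-tuple R[i]) :
  bilin (tuple_cons (z, t)) u =
  z * tnth u ord0 + bilin t [tuple tnth u (lift ord0 i) | i < n].
Proof.
rewrite /bilin big_ord_recl tnth0; congr (_ + _).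
by apply: eq_bigr => i _; rewrite tnthS tnth_mktuple.
Qed.

Lemma measurable_bilin_ball n (u : n.-tuple R[i]) w (s : R) :
  measurable [set a | normc (bilin a u + w) < s].
Proof.
apply: measurable_sublevel; apply: measurable_fun_normc.
by apply: measurable_funDC => //; exact: measurable_bilin.
Qed.

(* Conditioning on all the coordinates of [a] but the [j]th reduces the claim to
   the one-dimensional small ball estimate. *)
Lemma bilin_small_ball (P : probability R[i] R) (K : R) :
  0 <= K -> (forall w (q : R), 0 < q ->
    (P [set z | normc (z + w) < q]%R <= (K * q)%:E)%E) ->
  forall n (u : n.-tuple R[i]) j w (s : R), 0 < s -> tnth u j != 0 ->
  (power_probability P n [set a | normc (bilin a u + w) < s]%R <=
    (K * (s / normc (tnth u j)))%:E)%E.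
Proof.
move=> K0 PK; elim=> [u []//|n ih u j w s s0 uj0].
have mA := measurable_bilin_ball u w s.
have c0 : 0 < normc (tnth u j).
  rewrite lt0r normc_ge0 andbT; apply: contra uj0 => /eqP/eq0_normc ->.
  by rewrite eqxx.
have B0 : (0 <= (K * (s / normc (tnth u j)))%:E)%E.
  by rewrite lee_fin mulr_ge0// divr_ge0// ltW.
case: (unliftP ord0 j) uj0 c0 B0 => [i ->|->] ui0 c0 B0.
  (* The pivot is not the first coordinate: freeze the first one and absorb [z u_0] into the shift,
     which is why [w] is arbitrary in the induction. *)
  apply: (power_probabilityS_le_r B0 mA) => z.
  have := ih [tuple tnth u (lift ord0 i) | i < n] i (z * tnth u ord0 + w) s s0.
  rewrite tnth_mktuple => /(_ ui0).
  rewrite (_ : [set a | _] =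
    [set t | [set a | normc (bilin a u + w) < s] (tuple_cons (z, t))])//.
  by apply/seteqP; split=> t /=; rewrite bilin_cons addrCA addrA.
(* The pivot is the first coordinate: freeze the others and divide by [u_0], which leaves a ball of
   radius [s / |u_0|] for [z]. *)
apply: (power_probabilityS_le_l B0 mA) => t.
set v := bilin t [tuple tnth u (lift ord0 i) | i < n].
have := PK ((v + w) / tnth u ord0) (s / normc (tnth u ord0)).
rewrite divr_gt0// => /(_ isT).
rewrite (_ : [set z | _] =
  [set z | [set a | normc (bilin a u + w) < s] (tuple_cons (z, t))])//.
apply/seteqP; split=> z /=; rewrite bilin_cons -/v -addrA ltr_pdivlMr// -normcM;
  by rewrite mulrDl divfK.
Qed.

End bilinear_form_anticoncentration.

(** * Comparison of norms and forms with single coordinates *)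

Section coordinate_bounds.
Variable R : realType.

(** Take a maximal coordinate. This turns a large sum into an event about one coordinate, ready for
    a union bound. *)
Lemma sum_le_size_mul_coord n (x : 'I_n -> R) : (0 < n)%N ->
  exists j, \sum_i x i <= n%:R * x j.
Proof.
case: n x => // n x _; exists [arg max_(i > ord0) x i]%O.
case: arg_maxP => //= i _ xi; rewrite -[X in X%:R]card_ord mulr_natl -sumr_const.
by apply: ler_sum => j _; exact: xi.
Qed.

Lemma enorm_le_sum n (a : n.-tuple R[i]) :
  enorm a <= \sum_(j < n) normc (tnth a j).
Proof.
rewrite /enorm -[leRHS]ger0_norm; last first.
  by apply: sumr_ge0 => j _; exact: normc_ge0.
rewrite -sqrtr_sqr ler_sqrt ?sqr_ge0//.
(* Nonnegativity is part of the induction because the cross term of the square must be discarded. *)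
suff [] : 0 <= \sum_(j < n) normc (tnth a j) /\
  \sum_(j < n) normc (tnth a j) ^+ 2 <=
  (\sum_(j < n) normc (tnth a j)) ^+ 2 by [].
apply: (big_ind2 (fun x y => 0 <= x /\ y <= x ^+ 2)).
- by rewrite expr0n.
- move=> x1 x2 y1 y2 [x0 x21] [y0 y21]; split; first exact: addr_ge0.
  rewrite sqrrD; have : 0 <= x1 * y1 by exact: mulr_ge0.
  by rewrite mulr2n; lra.
- by move=> j _; rewrite normc_ge0.
Qed.

(** Guarantees that the supremum in the first condition is nonnegative; over an empty set it would
    be [-oo]. *)
Lemma unit_sphere_nonempty n : (0 < n)%N -> @unit_sphere R n !=set0.
Proof.
case: n => // n _; exists [tuple (i == ord0)%:R | i < n.+1].
rewrite /unit_sphere /= /enorm big_ord_recl tnth_mktuple eqxx normc1 expr1n.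
rewrite big1 ?addr0 ?sqrtr1// => i _.
by rewrite tnth_mktuple -[lift _ _ == _]/false mulr0n normc0 expr0n.
Qed.

Lemma unit_sphere_normc_le1 n (u : n.-tuple R[i]) j :
  unit_sphere u -> normc (tnth u j) <= 1.
Proof.
move=> u1; rewrite -[leRHS]u1 /enorm -[leLHS]ger0_norm ?normc_ge0//.
rewrite -sqrtr_sqr ler_sqrt; last by apply: sumr_ge0 => i _; exact: sqr_ge0.
by rewrite (bigD1 j)//= lerDl sumr_ge0// => i _; exact: sqr_ge0.
Qed.

Lemma bilin_le_sum n (a u : n.-tuple R[i]) : unit_sphere u ->
  normc (bilin a u) <= \sum_(j < n) normc (tnth a j).
Proof.
move=> u1; apply: (@le_trans _ _ (\sum_(j < n) normc (tnth a j * tnth u j))).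
  rewrite /bilin; apply: (big_ind2 (fun x y => normc x <= y)) => //.
    by rewrite normc0.
  by move=> x1 x2 y1 y2 ? ?; rewrite (le_trans (le_normcD _ _))// lerD.
apply: ler_sum => j _; rewrite normcM ler_piMr ?normc_ge0//.
exact: unit_sphere_normc_le1.
Qed.

(** [1 = ||u|| <= \sum_j |u_j| <= n max_j |u_j|]. *)
Lemma unit_sphere_coord n (u : n.-tuple R[i]) : (0 < n)%N -> unit_sphere u ->
  exists j, 1 <= n%:R * normc (tnth u j).
Proof.
move=> n0 u1.
have [j uj] := sum_le_size_mul_coord (fun j => normc (tnth u j)) n0.
by exists j; rewrite -[leLHS]u1 (le_trans (enorm_le_sum u)).
Qed.

End coordinate_bounds.

(** * Polynomial tails of [log ||a||] and [|log |<a, u>||] *)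

Section logarithmic_tails.
Variables (R : realType) (P : probability R[i] R) (C rho : R).
Hypotheses (C_gt0 : 0 < C) (rho_gt0 : 0 < rho).
Hypothesis tailP : forall r : R, 1 <= r ->
  (P [set z : R[i] | r%:E < elog (normc z)] <= (C / r `^ rho)%:E)%E.

(** The constant that converts the exponential decay [e^(-r/2)] into [r^-rho]. *)
Let K1 : R := expR (rho * ln (2 * rho)).

Let K1_expR r : 0 < r -> expR (- (r / 2)) <= K1 * r `^ (- rho).
Proof.
move=> r0; rewrite powRN expRN ler_pdivlMr ?powR_gt0//.
by rewrite ler_pdivrMl ?expR_gt0// mulrC powR_le_expR_half.
Qed.

Lemma measurable_exists_gt n (s : R) :
  measurable [set a : n.-tuple R[i] | exists j, s < n%:R * normc (tnth a j)].
Proof.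
apply: (@measurable_exists_tnth _ _ _ [set z : R[i] | s < n%:R * normc z]).
apply: measurable_superlevel; apply: measurable_funM => //.
exact: measurable_fun_normc.
Qed.

Lemma exists_coord_tail : exists2 K : R, 0 <= K &
  forall n (r : R), (0 < n)%N -> 0 < r ->
  (power_probability P n
     [set a | exists j, expR r < n%:R * normc (tnth a j)]%R <=
   (K * n%:R * r `^ (- rho))%:E)%E.
Proof.
have K10 : 0 < K1 := expR_gt0 _.
have c0 : 0 < (2 : R) `^ rho by exact: powR_gt0.
(* One summand for each case: [r < 2], then [n > e^(r/2)], then the union bound. *)
exists (2 `^ rho + K1 + C * 2 `^ rho) => [|n r n0 r0].
  by rewrite !addr_ge0 ?mulr_ge0// ltW.
have [[C0 K1_0] c0'] := (ltW C_gt0, ltW K10, ltW c0).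
have n1 : 1 <= n%:R :> R by rewrite ler1n.
have p0 : 0 < r `^ (- rho) by exact: powR_gt0.
set p := r `^ (- rho) in p0 *; have p0' := ltW p0.
have triv : 1 <= 2 `^ rho * p \/ 1 <= K1 * n%:R * p ->
    (power_probability P n
     [set a | exists j, expR r < n%:R * normc (tnth a j)]%R <=
      ((2 `^ rho + K1 + C * 2 `^ rho) * n%:R * p)%:E)%E.
  move=> h; apply: (le_trans (probability_le1 _ _)); first exact: measurable_exists_gt.
  rewrite lee_fin.
  have C2 : 0 <= C * 2 `^ rho * n%:R * p by rewrite !mulr_ge0.
  have K12 : 0 <= K1 * n%:R * p by rewrite !mulr_ge0.
  have : 0 < 2 `^ rho * p by rewrite mulr_gt0.
  move=> h2; have h3 : 2 `^ rho * p <= 2 `^ rho * p * n%:R.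
    by rewrite ler_peMr// ltW.
  by rewrite !mulrDl -[_ * n%:R * p in leRHS]mulrAC; case: h; lra.
(* The hypothesis on [P] will be used at level [r / 2], which must be at least 1; for [r < 2] the
   claimed bound exceeds 1. *)
have [r2|r2] := ltP r 2.
  apply: triv; left; rewrite /p powRN ler_pdivlMr ?powR_gt0// mul1r.
  by rewrite ge0_ler_powR ?nnegrE// ?ltW.
have [ne|ne] := ltP (expR (r / 2)) n%:R.
  apply: triv; right.
  have /(ler_wpM2l (ler0n R n)) := K1_expR r0.
  rewrite mulrCA mulrA; apply: le_trans.
  by rewrite expRN ler_pdivlMr ?expR_gt0// mul1r ltW.
(* Now [n <= e^(r/2)], so [e^r < n |a_j|] forces [|a_j| > e^(r/2)]. *)
pose B := [set z : R[i] | ((r / 2)%:E < elog (normc z))%E].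
have BE : B = [set z | expR (r / 2) < normc z].
  by apply/seteqP; split=> z; rewrite /B /= elog_gtE.
have mB : measurable B.
  rewrite BE; apply: measurable_superlevel; exact: measurable_fun_normc.
apply: (@le_trans _ _ (power_probability P n [set a | exists j, B (tnth a j)])).
  apply: le_measure; rewrite ?inE.
  - exact: measurable_exists_gt.
  - exact: (@measurable_exists_tnth _ _ n B mB).
  - move=> a [j] aj; exists j; rewrite BE /=.
    have e0 := expR_gt0 (r / 2).
    rewrite -(ltr_pM2l e0) -expRD (_ : r / 2 + r / 2 = r); last by field.
    by apply: (lt_le_trans aj); rewrite ler_wpM2r ?normc_ge0.
apply: (le_trans (power_probability_exists_le P n mB)).
have r1 : 1 <= r / 2 by lra.
apply: (@le_trans _ _ (n%:R%:E * (C / (r / 2) `^ rho)%:E)%E).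
  by rewrite lee_wpmul2l ?lee_fin// tailP.
rewrite -EFinM lee_fin.
have x0 : 0 < (r / 2) `^ rho by rewrite powR_gt0// divr_gt0.
have pE : p = ((r / 2) `^ rho * 2 `^ rho)^-1.
  by rewrite /p powRN -powRM ?divr_ge0 ?(ltW r0)// divfK.
have -> : n%:R * (C / (r / 2) `^ rho) = C * 2 `^ rho * n%:R * p.
  by rewrite pE; field; rewrite !gt_eqF.
by rewrite ler_wpM2r// ler_wpM2r// lerDr addr_ge0.
Qed.

Lemma enorm_log_tail : exists2 K : R, 0 <= K &
  forall n (r : R), (0 < n)%N -> 0 < r ->
  (power_probability P n [set a | r%:E < elog (enorm a)] <=
   (K * n%:R * r `^ (- rho))%:E)%E.
Proof.
have [K K0 KP] := exists_coord_tail; exists K => // n r n0 r0.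
apply: le_trans (KP n r n0 r0); under eq_set do rewrite elog_gtE.
apply: le_measure; rewrite ?inE; [|exact: measurable_exists_gt|].
  by apply: measurable_superlevel; exact: measurable_enorm.
move=> a /= ra.
have [j aj] := sum_le_size_mul_coord (fun j => normc (tnth a j)) n0.
by exists j; apply: lt_le_trans ra (le_trans (enorm_le_sum a) aj).
Qed.

Lemma bilin_log_tail (K0 : R) : 0 <= K0 -> (forall w (q : R), 0 < q ->
    (P [set z | normc (z + w) < q]%R <= (K0 * q)%:E)%E) ->
  exists2 K : R, 0 <= K &
  forall n (u : n.-tuple R[i]) (r : R), (0 < n)%N -> unit_sphere u -> 0 < r ->
  (power_probability P n [set a | r%:E < `|elog (normc (bilin a u))|] <=
   (K * n%:R * r `^ (- rho))%:E)%E.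
Proof.
move=> K0_ge0 PK0; have [K K_ge0 KP] := exists_coord_tail.
have K1_ge0 : 0 <= K1 := expR_ge0 _.
exists (K + K0 * K1) => [|n u r n0 u1 r0]; first by rewrite addr_ge0// mulr_ge0.
pose A := [set a : n.-tuple R[i] | exists j, expR r < n%:R * normc (tnth a j)].
pose B := [set a : n.-tuple R[i] | normc (bilin a u + 0) < expR (- r)].
have mA : measurable A by exact: measurable_exists_gt.
have mB : measurable B by exact: measurable_bilin_ball.
apply: (@le_trans _ _ (power_probability P n (A `|` B))).
  apply: le_measure; rewrite ?inE; [|exact: measurableU mA mB|].
    have mf : measurable_fun setT (fun a => `|elog (normc (bilin a u))|%E).
      apply: measurableT_comp => //; apply: measurable_fun_elog.
      by apply: measurable_fun_normc; exact: measurable_bilin.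
    by rewrite -[X in measurable X]setTI; exact: emeasurable_fun_o_infty.
  move=> a /= ra.
  (* The value [-oo], taken where [<a, u> = 0], falls on the small side. *)
  have [{}ra|{}ra] : (r%:E < elog (normc (bilin a u)) \/
      elog (normc (bilin a u)) < (- r)%:E)%E.
  - move: ra; case: (elog _) => [x| |] /=; rewrite ?ltry ?ltNyr ?lte_fin;
      [|by left|by right].
    by rewrite real_ltr_normr ?num_real// => /orP[?|?]; [left|right; lra].
  - left; rewrite elog_gtE in ra.
    have [j aj] := sum_le_size_mul_coord (fun j => normc (tnth a j)) n0.
    by exists j; apply: lt_le_trans ra (le_trans (bilin_le_sum a u1) aj).
  - by right; rewrite elog_ltE in ra; rewrite /B /= addr0.
apply: (le_trans (measureU2 _ mA mB)).
rewrite 2!mulrDl EFinD; apply: leeD; first exact: KP.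
(* With [|u_j| >= 1/n], the small ball bound is [K0 e^-r / |u_j| <= K0 n e^-r], and
   [e^-r <= e^(-r/2)]. *)
have [j uj] := unit_sphere_coord n0 u1.
have n_gt0 : 0 < n%:R :> R by rewrite ltr0n.
have uj0 : 0 < normc (tnth u j) by rewrite -(pmulr_rgt0 _ n_gt0) (lt_le_trans _ uj).
apply: (le_trans (bilin_small_ball K0_ge0 PK0 (j := j) _ (expR_gt0 _) _)).
  by apply: contraTneq uj0 => ->; rewrite normc0 ltxx.
rewrite lee_fin -!mulrA ler_wpM2l// ler_pdivrMr//.
apply: (@le_trans _ _ (K1 * r `^ (- rho))).
  apply: le_trans (K1_expR r0); rewrite ler_expR; lra.
rewrite -!mulrA ler_wpM2l// mulrCA ler_peMr ?powR_ge0//.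
Qed.

End logarithmic_tails.

(** * Expectation from a polynomial tail *)

Section expectation_of_polynomial_tail.
Context {d} {T : measurableType d} {R : realType} (mu : probability T R).
Variable Y : T -> \bar R.
Hypotheses (mY : measurable_fun setT Y) (Y0 : forall a, (0 <= Y a)%E).
Variable lam : R.
Hypothesis lam_gt0 : 0 < lam.

Let A k := [set a | ((lam * 2 ^+ k)%:E < Y a)%E].
Let f k a := ((lam * 2 ^+ k)%:E * (\1_(A k) a)%:E)%E.

Let mA k : measurable (A k).
Proof. by rewrite -[X in measurable X]setTI; exact: emeasurable_fun_o_infty. Qed.

Let lamk_ge0 k : 0 <= lam * 2 ^+ k.
Proof. by rewrite mulr_ge0// ?exprn_ge0// ltW. Qed.

Let f0 k a : (0 <= f k a)%E.
Proof. by rewrite /f mule_ge0 ?lee_fin. Qed.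

Let mf k : measurable_fun setT (f k).
Proof. by apply: measurable_funeM; apply/measurable_EFinP. Qed.

(** Raising the truncation level from [lam 2^n] to [lam 2^(n+1)] adds at most [lam 2^n], and only
    where [Y > lam 2^n]: this is [f n]. Truncating keeps the induction valid where [Y] is
    infinite. *)
Let truncation_le n a :
  (mine (Y a) (lam * 2 ^+ n)%:E <= lam%:E + \sum_(k < n) f k a)%E.
Proof.
elim: n => [|n ih]; first by rewrite big_ord0 adde0 expr0 mulr1 ge_min lexx orbT.
rewrite big_ord_recr/= addeA; apply: le_trans (leeD ih (lexx _)).
rewrite /f indicE; have [aA|aA] := boolP (a \in A n).
  rewrite mule1 exprS mulrCA mulr_natl mulr2n EFinD.
  move: aA; rewrite inE /A /= => /ltW aA; rewrite [in leRHS]/mine ltNge aA/=.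
  by rewrite ge_min lexx orbT.
rewrite mule0 adde0; move: aA; rewrite notin_setE /A /= => /negP; rewrite -leNgt.
move=> Yn; rewrite [in leRHS]min_l// ge_min lexx//.
Qed.

Let pointwise_le a : (Y a <= lam%:E + \sum_(k <oo) f k a)%E.
Proof.
have h n : (mine (Y a) (lam * 2 ^+ n)%:E <= lam%:E + \sum_(k <oo) f k a)%E.
  apply: (le_trans (truncation_le n a)); rewrite leeD2l//.
  by rewrite -(big_mkord xpredT (f^~ a)); exact: nneseries_lim_ge.
have S0 : (0 <= \sum_(k <oo) f k a)%E by exact: nneseries_ge0.
case: (\sum_(k <oo) f k a)%E S0 h => [x| |]//.
  rewrite lee_fin => x0 h.
  (* At a level above the finite bound [lam + x] the minimum can only be [Y a] itself. *)
  have [n xn] : exists n, lam + x < lam * 2 ^+ n.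
    exists (Num.bound ((lam + x) / lam)); rewrite -ltr_pdivrMl// mulrC.
    have b0 : 0 <= (lam + x) / lam by rewrite divr_ge0// ?addr_ge0// ltW.
    apply: (lt_trans (archi_boundP b0)).
    by rewrite -natrX ltr_nat ltn_expl.
  have := h n; rewrite /mine; case: ifPn => // _.
  by rewrite -EFinD lee_fin leNgt xn.
by move=> _ _; rewrite addey// leey.
Qed.

(* Splitting dyadically at the levels [lam 2^k]:
   [Y <= lam + \sum_k lam 2^k 1_{Y > lam 2^k}]. *)
Lemma expectation_le_of_tail (K s : R) : 0 <= K -> 1 < s ->
  (forall r : R, 0 < r -> (mu [set a | r%:E < Y a] <= (K * r `^ (- s))%:E)%E) ->
  (\int[mu]_a Y a <= (lam + K * lam `^ (1 - s) / (1 - 2 `^ (1 - s)))%:E)%E.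
Proof.
move=> K0 s1 tail.
apply: (@le_trans _ _ (\int[mu]_a (lam%:E + \sum_(k <oo) f k a))%E).
  apply: ge0_le_integral => //.
  apply: emeasurable_funD => //; exact: ge0_emeasurable_sum.
rewrite ge0_integralD//; last 3 first.
- by move=> a _; exact: ltW.
- by move=> a _; exact: nneseries_ge0.
- exact: ge0_emeasurable_sum.
rewrite EFinD; apply: leeD.
  rewrite integral_cst// [X in (_ * X)%E](_ : _ = 1%E) ?mule1//.
  exact: probability_setT.
rewrite integral_nneseries//; apply: lime_le.
  by apply: is_cvg_nneseries => n _ _; exact: integral_ge0.
apply: nearW => n.
(* The tail bound makes the [k]th term at most [K (lam 2^k)^(1-s) = K lam^(1-s) q^k], a geometric
   series. *)
set q := 2 `^ (1 - s); have q0 : 0 < q by rewrite powR_gt0.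
have q1 : q < 1.
  have l2 : 0 < ln (2 : R) by rewrite ln_gt0// ltr1n.
  by rewrite /q /powR gt_eqF// expR_lt1 pmulr_llt0// subr_lt0.
apply: (@le_trans _ _ (\sum_(0 <= k < n) (K * lam `^ (1 - s) * q ^+ k)%:E)%E).
  apply: lee_sum => k _; rewrite /f ge0_integralZl//; last by rewrite lee_fin.
  rewrite integral_indic// setIT.
  have lk0 : 0 < lam * 2 ^+ k by rewrite mulr_gt0// exprn_gt0.
  apply: (le_trans (lee_wpmul2l _ (tail _ lk0))); first by rewrite lee_fin.
  rewrite -EFinM lee_fin mulrCA.
  have -> : lam * 2 ^+ k * (lam * 2 ^+ k) `^ (- s) = (lam * 2 ^+ k) `^ (1 - s).
    by rewrite powRD ?powRr1 ?(ltW lk0)// (gt_eqF lk0) implybT.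
  rewrite powRM ?(ltW lam_gt0) ?exprn_ge0// mulrA -powR_mulrn// -powRrM mulrC.
  by rewrite [k%:R * _]mulrC powRrM powR_mulrn ?(ltW q0)// mulrC.
  by apply/measurable_EFinP; exact: measurable_indic.
rewrite sumEFin lee_fin (le_trans _ (geometric_le_lim n _ _ _))//.
- by rewrite mulr_ge0// powR_ge0.
- by rewrite gtr0_norm.
Qed.

End expectation_of_polynomial_tail.

(** * Lattice points of dilates: [1 <= d_N = O(N^m)] *)

Section lattice_points_of_dilates.
Variables (R : realType) (m : nat).
Implicit Types Delta : set 'rV[R]_m.

Lemma convex_box (B : R) :
  @convex_set R 'rV[R]_m [set x : 'rV[R]_m | forall j, `|x 0 j| <= B].
Proof.
move=> x y l /set_mem xB /set_mem yB; apply/mem_set => /= j.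
rewrite /conv /= !mxE (le_trans (ler_normD _ _))// !normrM.
have l1 : 0 <= unstable.onem l%:num by rewrite unstable.onem_ge0.
rewrite (ger0_norm l1) [X in X * _ + _]ger0_norm//.
have -> : B = l%:num * B + unstable.onem l%:num * B.
  by rewrite -mulrDl unstable.add_onemK mul1r.
by apply: lerD; apply: ler_wpM2l.
Qed.

Lemma integral_polytope_bounded Delta : integral_polytope Delta ->
  exists B : nat, forall x, Delta x -> forall j, `|x 0 j| <= B%:R.
Proof.
move=> [S [finS _ ->]].
(* The cube bounding all vertices is convex, hence contains their hull. *)
exists (\max_(v <- fset_set S) \max_(j < m) `|v 0%R j|%N).
apply: smallest_sub; first exact: convex_box.
move=> _ [v Sv <-] j; rewrite /lattice_point mxE -intr_norm -abszE.
rewrite -[_%:~R]/(_%:R) ler_nat.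
apply: (@leq_trans (\max_(j < m) `|v 0%R j|%N)); first exact: leq_bigmax.
apply: (@leq_bigmax_seq _ _ xpredT
  (fun v : 'rV[int]_m => \max_(j < m) `|v 0%R j|%N)) => //.
by rewrite in_fset_set//; exact: mem_set.
Qed.

(** Enumerates the integer points of [[-M, M]^m] by functions into [2 M + 1] values, so that
    counting them is immediate. *)
Let box_point (M : nat) (f : {ffun 'I_m -> 'I_(M.*2.+1)}) : 'rV[int]_m :=
  \row_j ((f j : nat)%:Z - M%:Z).

Let box_points M : seq 'rV[int]_m :=
  [seq box_point f | f : {ffun 'I_m -> 'I_(M.*2.+1)}].

Let box_pointsP M (v : 'rV[int]_m) : (forall j, `|v 0 j| <= M%:Z) ->
  v \in box_points M.
Proof.
move=> vM.
have vM' j : (`|(v 0 j + M%:Z)%R| < M.*2.+1)%N.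
  by have := vM j; lia.
apply/mapP; exists [ffun j => Ordinal (vM' j)]; first by rewrite mem_enum.
apply/rowP => j; rewrite mxE ffunE /=.
by have := vM j; lia.
Qed.

Let dilate_box_points Delta (B N : nat) :
  (forall x, Delta x -> forall j, `|x 0 j| <= B%:R) ->
  [set v : 'rV[int]_m | dilate N Delta (lattice_point R v)] `<=`
  [set` box_points (N * B)].
Proof.
move=> DB v [x Dx /rowP xv]; apply: box_pointsP => j.
have := xv j; rewrite !mxE => vj.
rewrite -(ler_int R) intr_norm -vj normrM ger0_norm//.
by rewrite PoszM intrM ler_wpM2l// DB.
Qed.

Lemma lattice_count_dilate_le Delta : integral_polytope Delta ->
  exists K : nat, forall N, (0 < N)%N ->
    (lattice_count (dilate N Delta) <= K * N ^ m)%N.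
Proof.
move=> /integral_polytope_bounded[B DB]; exists (B.*2.+1 ^ m)%N => N N0.
rewrite -expnMn; have sub := @dilate_box_points Delta B N DB.
apply: (@leq_trans (size (box_points (N * B)))).
  apply: uniq_leq_size; first exact: fset_uniq.
  move=> v; rewrite in_fset_set; first by move=> /set_mem/sub.
  exact: sub_finite_set sub (finite_seq _).
have leX a b e : (a <= b)%N -> (a ^ e <= b ^ e)%N.
  by case: e => // e ab; rewrite leq_exp2r.
(* [2 N B + 1 <= (2 B + 1) N] because [N >= 1]. *)
by rewrite size_map -cardT card_ffun !card_ord leX//; nia.
Qed.

(** [N] times a vertex is a lattice point of the dilate. Boundedness is still used, since [fset_set]
    needs a finite set. *)
Lemma lattice_count_dilate_gt0 Delta N : integral_polytope Delta ->
  (0 < lattice_count (dilate N Delta))%N.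
Proof.
move=> iD; have [B DB] := integral_polytope_bounded iD.
have sub := @dilate_box_points Delta B N DB.
case: iD => S [finS [v Sv] DE].
have Dv : Delta (lattice_point R v).
  by rewrite DE => X [_]; apply; exists v.
rewrite /lattice_count cardfs_gt0; apply/fset0Pn; exists (v *+ N).
rewrite in_fset_set; last exact: sub_finite_set sub (finite_seq _).
apply: mem_set; exists (lattice_point R v) => //.
apply/rowP => j.
by rewrite !mxE mulmxnE rmorphMn/= mulr_natl.
Qed.

End lattice_points_of_dilates.

(** * Summability and limits from power bounds *)

Section asymptotics.
Variable R : realType.

Lemma nneseries_lty_le_powRN (a : nat -> \bar R) (c s : R) : 1 < s -> 0 <= c ->
  (forall N, (0 <= a N)%E) ->
  (forall N, (0 < N)%N -> (a N <= (c * N%:R `^ (- s))%:E)%E) ->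
  (\sum_(1 <= N <oo) a N < +oo)%E.
Proof.
move=> s1 c0 a0 ac.
apply: (@le_lt_trans _ _ (\sum_(1 <= N <oo) (c%:E * (N%:R `^ (- s))%:E))%E).
  apply: lee_lim.
  - by apply: is_cvg_nneseries.
  - apply: is_cvg_nneseries => N _ _.
    by rewrite -EFinM lee_fin mulr_ge0 ?powR_ge0.
  apply: nearW => n; rewrite big_nat_cond [leRHS]big_nat_cond.
  by apply: lee_sum => N /andP[/andP[N0 _] _]; exact: ac.
rewrite nneseriesZl; last by move=> N _; rewrite lee_fin powR_ge0.
by rewrite lte_mul_pinfty// ?lee_fin// nneseries_powRN_lty.
Qed.

(** The dimension growth costs [m] powers of [N], leaving the exponent [rho - m], which exceeds 1
    when [rho > m + 1]. *)
Lemma natr_mul_powRN_le (m D n N : nat) (e rho : R) : 0 < e -> (0 < N)%N ->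
  (n <= D * N ^ m)%N ->
  n%:R * (N%:R * e) `^ (- rho) <=
  D%:R * e `^ (- rho) * N%:R `^ (- (rho - m%:R)).
Proof.
move=> e0 N0 nD; have N0' : 0 < N%:R :> R by rewrite ltr0n.
have -> : N%:R `^ (- (rho - m%:R)) = N%:R ^+ m * N%:R `^ (- rho).
  by rewrite opprB powRD ?(gt_eqF N0') ?implybT// powR_mulrn.
rewrite powRM ?(ltW e0)//.
have := powR_ge0 N%:R (- rho); have := powR_ge0 e (- rho).
move: (_ `^ _) (_ `^ _) => x y x0 y0.
rewrite [leRHS](_ : _ = (D%:R * N%:R ^+ m) * (x * y)); last by ring.
by rewrite ler_wpM2r ?mulr_ge0// -natrX -natrM ler_nat.
Qed.

(** [M] may depend on [e]: fix [e] first, then let [N] grow until [M / N] is small. *)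
Lemma ereal_cvg0_le (f : nat -> \bar R) :
  (forall N, (0 < N)%N -> (0 <= f N)%E) ->
  (forall e : R, 0 < e -> exists2 M : R, 0 <= M &
     forall N, (0 < N)%N -> (f N <= (e + M * N%:R^-1)%:E)%E) ->
  f @ \oo --> 0%E.
Proof.
move=> f0 fM.
have fin : \forall N \near \oo, f N \is a fin_num.
  have [M _ h] := fM 1 ltr01.
  near=> N; have N0 : (0 < N)%N by near: N; exact: nbhs_infty_gt.
  by rewrite ge0_fin_numE ?f0// (le_lt_trans (h N N0))// ltry.
apply/fine_cvgP; split => //.
apply/cvgr0Pnorm_le => e e0.
have e20 : 0 < e / 2 by rewrite divr_gt0.
have [M M0 h] := fM _ e20.
near=> N; have N0 : (0 < N)%N by near: N; exact: nbhs_infty_gt.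
have fN : f N \is a fin_num by near: N.
rewrite /= ger0_norm ?fine_ge0 ?f0// -lee_fin fineK//.
apply: (le_trans (h N N0)); rewrite lee_fin.
have : M * N%:R^-1 <= e / 2.
  rewrite ler_pdivrMr ?ltr0n// -ler_pdivrMl//.
  by near: N; exact: nbhs_infty_ger.
lra.
Unshelve. all: by end_near. Qed.

End asymptotics.

Theorem proposition3p1 (R : realType) (m : nat) (Delta : set 'rV[R]_m)
  (polyDelta : integral_polytope Delta)
  (intDelta : interior Delta !=set0)
  (P : probability R[i] R)
  (densP :
    (exists phi : R[i] -> R,
      (exists M : R, forall z, `|phi z| <= M) /\ complex_density P phi) \/
    (exists phi : R -> R,
      (exists M : R, forall x, `|phi x| <= M) /\ real_density P phi))
  (C rho : R) (C_gt0 : 0 < C) (rho_gt : m.+1%:R < rho)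
  (tailP : forall r : R, 1 <= r ->
    (P [set z : R[i] | r%:E < elog (normc z)] <= (C / r `^ rho)%:E)%E) :
  let d (N : nat) := lattice_count (dilate N Delta) in
  let sigma (N : nat) := power_probability P (d N) in
  [/\ (fun N : nat =>
         (ereal_sup [set `|\int[sigma N]_a elog (normc (bilin a u))|
                    | u in @unit_sphere R (d N)] * (N%:R^-1)%:E)%E)
        @ \oo --> 0%E,
      forall eps : R, 0 < eps ->
        (\sum_(1 <= N <oo)
          sigma N [set a | (N%:R * eps)%:E < elog (enorm a)] < +oo)%E
    & forall u : forall N : nat, (d N).-tuple R[i],
        (forall N : nat, (1 <= N)%N -> unit_sphere (u N)) ->
        forall t : R, 0 < t ->
        (\sum_(1 <= N <oo)
          sigma N [set a | (elog (normc (bilin a (u N)))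
                            < (- (N%:R * t))%:E)%E] < +oo)%E].
Proof.
move=> d sigma.
have rho_gt0 : 0 < rho by apply: le_lt_trans rho_gt.
have rho1 : 1 < rho by apply: le_lt_trans rho_gt; rewrite ler1n.
have s1 : 1 < rho - m%:R by move: rho_gt; rewrite -natr1; lra.
have [K0 K0_ge0 PK0] := bounded_density_small_ball densP.
have [K K_ge0 tail] := bilin_log_tail C_gt0 rho_gt0 tailP K0_ge0 PK0.
have [K' K'_ge0 tail'] := enorm_log_tail C_gt0 rho_gt0 tailP.
have [D dD] := @lattice_count_dilate_le R m Delta polyDelta.
have d0 N : (0 < d N)%N by exact: lattice_count_dilate_gt0.
have mf N (u : (d N).-tuple R[i]) :
    measurable_fun setT (fun a => elog (normc (bilin a u))).
  apply: measurable_fun_elog; apply: measurable_fun_normc; exact: measurable_bilin.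
have mabsf N (u : (d N).-tuple R[i]) :
    measurable_fun setT (fun a => `|elog (normc (bilin a u))|%E).
  by apply: measurableT_comp => //; exact: mf.
(* Both tail bounds at [r = N e], in the form used for all three conditions. *)
have scaled (c e : R) N : 0 <= c -> 0 < e -> (0 < N)%N ->
    c * (d N)%:R * (N%:R * e) `^ (- rho) <=
    c * D%:R * e `^ (- rho) * N%:R `^ (- (rho - m%:R)).
  move=> c0 e0 N0; rewrite -!mulrA ler_wpM2l// mulrA natr_mul_powRN_le//.
  exact: dD.
have Ne0 (e : R) N : 0 < e -> (0 < N)%N -> 0 < N%:R * e.
  by move=> e0 N0; rewrite mulr_gt0// ltr0n.
split.
- apply: ereal_cvg0_le => [N N0|e e0].
    rewrite mule_ge0 ?lee_fin ?invr_ge0//.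
    have [u u1] := @unit_sphere_nonempty R _ (d0 N).
    by apply: (le_trans (abse_ge0 _)); apply: ereal_sup_ubound; exists u.
  pose c := (1 - 2 `^ (1 - rho))^-1 : R.
  have c0 : 0 <= c.
    rewrite invr_ge0 subr_ge0 -[leRHS](powRr0 2) ler_powR ?ler1n//; lra.
  (* The expectation is at most [N e + K d_N (N e)^(1-rho) c]. Since
     [(N e)^(1-rho) = N e (N e)^-rho] and [d_N (N e)^-rho <= D e^-rho / N], the second term is at
     most [M]. *)
  pose M := K * D%:R * e `^ (- rho) * e * c.
  have M0 : 0 <= M by rewrite !mulr_ge0 ?powR_ge0// ltW.
  exists M => // N N0; have N0' : 0 < N%:R :> R by rewrite ltr0n.
  rewrite lee_pdivrMr// -EFinM; apply: ge_ereal_sup => _ [u u1 <-].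
  apply: (le_trans (le_abse_integral _ measurableT (mf N u))).
  have Kd0 : 0 <= K * (d N)%:R by rewrite mulr_ge0.
  apply: (le_trans (expectation_le_of_tail (mabsf N u) (fun a => abse_ge0 _)
    (Ne0 _ _ e0 N0) Kd0 rho1 (fun r r0 => tail _ _ _ (d0 N) u1 r0))).
  rewrite lee_fin -/c mulrDl divfK ?gt_eqF//.
  have Ne := Ne0 _ _ e0 N0.
  have -> : (N%:R * e) `^ (1 - rho) = N%:R * e * (N%:R * e) `^ (- rho).
    by rewrite powRD ?powRr1 ?(ltW Ne)// (gt_eqF Ne) implybT.
  have := scaled K e N K_ge0 e0 N0.
  have Ns : N%:R `^ (- (rho - m%:R)) <= N%:R^-1 :> R.
    rewrite -powR_inv1 ?ler_powR ?ler1n//; lra.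
  have W0 : 0 <= K * D%:R * e `^ (- rho) by rewrite !mulr_ge0 ?powR_ge0.
  move=> /le_trans/(_ (ler_wpM2l W0 Ns)); rewrite ler_pdivlMr// => h.
  rewrite [e * _]mulrC lerD2l.
  rewrite (_ : _ * c = K * (d N)%:R * (N%:R * e) `^ (- rho) * N%:R * (e * c)).
    by rewrite /M -!(mulrA _ e c) ler_wpM2r// mulr_ge0// ltW.
  ring.
- move=> eps eps0.
  apply: (nneseries_lty_le_powRN s1 (c := K' * D%:R * eps `^ (- rho))) => //.
    by rewrite !mulr_ge0 ?powR_ge0.
  move=> N N0; apply: (le_trans (tail' _ _ (d0 N) (Ne0 _ _ eps0 N0))).
  by rewrite lee_fin scaled.
- move=> u u1 t t0.
  apply: (nneseries_lty_le_powRN s1 (c := K * D%:R * t `^ (- rho))) => //.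
    by rewrite !mulr_ge0 ?powR_ge0.
  move=> N N0; have Nt0 := Ne0 _ _ t0 N0.
  (* A logarithm below [- N t], possibly [-oo], has absolute value above [N t]. *)
  apply: (@le_trans _ _ (sigma N
      [set a | ((N%:R * t)%:E < `|elog (normc (bilin a (u N)))|)%E])).
    have [mfu mabsfu] := (mf N (u N), mabsf N (u N)).
    apply: le_measure; rewrite ?inE.
    + by rewrite -[X in measurable X]setTI; exact: emeasurable_fun_infty_o.
    + by rewrite -[X in measurable X]setTI; exact: emeasurable_fun_o_infty.
    + move=> a /=; case: (elog _) => [x| |] //=; rewrite ?ltry// !lte_fin => xt.
      by rewrite ler0_norm; lra.
  apply: (le_trans (tail _ _ _ (d0 N) (u1 N N0) Nt0)).
  by rewrite lee_fin scaled.
Qed.
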